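(* Let $G$ be a partial group, let $H$ be a partial subgroup of $G$ and let $K$ be a normal partial subgroup of $G$. Then there is a natural isomorphism of partial groups $$HK/K\longrightarrow H/(H\cap K),\qquad aK\longmapsto a(H\cap K)\quad (a\in H).$$
   Context: Let $\Gamma$ be a group with neutral element $e$, and let juxtaposition denote its product. Two subgroups $E,\widetilde D$ of $\Gamma$ are supplement in $\Gamma$ if $E\cap\widetilde D=\{e\}$ and $\{xd: x\in E, d\in\widetilde D\}=\Gamma$. A subset $D\subset\Gamma$ is free with $E$ in $\Gamma$ if $e\in D$ and there is a subgroup $\widetilde D\supset D$ that is a supplement of $E$ in $\Gamma$. A partial group $G=E.D$ with support $E$ and defect $D$ is given by a group $\Gamma$, a subgroup $E$ and a subset $D$ free with $E$ in $\Gamma$: its underlying set is $G=E.D=\{xd: x\in E,d\in D\}\subset\Gamma$ (each $a\in G$ is written uniquely as $a=xd$, $x\in E$, $d\in D$), with the partial law $a.b:=xy$ for $a=xd$, $b=yd'$ ($x,y\in E$, $d,d'\in D$). For $a=xd\in G$, $Inv(a)=\{x^{-1}d': d'\in D\}$. Every group is regarded as a partial group with support itself and defect $\{e\}$. A subset $H\subset G$ is a partial subgroup of $G$ if $e\in H$, $a.b\in H$ for all $a,b\in H$, and $Inv(a)\cap H\ne\emptyset$ for all $a\in H$. For $a\in G$: $aH=\{a.h:h\in H\}$, $Ha=\{h.a:h\in H\}$. $H$ is normal in $G$ if $aH=Ha$ for all $a\in G$. For partial subgroups $H,K$ of $G$, $HK=\{h.k: h\in H,k\in K\}$. With $K$ normal,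 $HK/K$ denotes the set of cosets $aK$ with $a\in HK$, and $H/(H\cap K)$ the set of cosets $a(H\cap K)$ with $a\in H$, with operations $(aK)(bK)=(a.b)K$ and $(a(H\cap K))(b(H\cap K))=(a.b)(H\cap K)$; these quotients are groups. A homomorphism of partial groups $f:G_1=E_1.D_1\to G_2=E_2.D_2$ is a map with $f(E_1)\subset E_2$, $f(D_1)\subset D_2$ and $f(g.h).e=f(g).f(h)$ for all $g,h\in G_1$ (with $e$ the neutral element of $G_2$). An isomorphism is a homomorphism that is one-to-one and onto. *)

(* Defs.v *)
From HB Require Import structures.
From mathcomp Require Import all_boot.
From mathcomp Require Import mathcomp_extra boolp classical_sets functions.

Set Implicit Arguments.
Unset Strict Implicit.
Unset Printing Implicit Defensive.

Local Open Scope classical_set_scope.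
Local Open Scope group_scope.

Definition supplement (Gamma : groupType) (E D : set Gamma) : Prop :=
  [/\ group_closed (mem E), group_closed (mem D), E `&` D = [set 1] &
      [set x * d | x in E & d in D] = setT].

Definition free_with (Gamma : groupType) (E D : set Gamma) : Prop :=
  D 1 /\ exists D' : set Gamma, D `<=` D' /\ supplement E D'.

Record partialGroup := PartialGroup {
  ambient : groupType;
  support : set ambient;
  defect : set ambient;
  support_group : group_closed (mem support);
  defect_free : free_with support defect }.

Arguments support : clear implicits.
Arguments defect : clear implicits.

Definition carrier (G : partialGroup) : set (ambient G) :=
  [set x * d | x in support G & d in defect G].

Arguments carrier : clear implicits.

(* The x of the unique decomposition a = x d, with x in the support and d in
   the defect; the value 1 for a outside the carrier is a dummy. *)
Definition supp (G : partialGroup) (a : ambient G) : ambient G :=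
  xget 1 [set x | support G x /\ exists2 d, defect G d & a = x * d].

Definition pmul (G : partialGroup) (a b : ambient G) : ambient G :=
  supp a * supp b.

Definition pinv (G : partialGroup) (a : ambient G) : set (ambient G) :=
  [set (supp a)^-1 * d | d in defect G].

Definition partial_subgroup (G : partialGroup) (H : set (ambient G)) : Prop :=
  [/\ H `<=` carrier G, H 1,
      forall a b, H a -> H b -> H (pmul a b) &
      forall a, H a -> pinv a `&` H !=set0].

Definition lcoset (G : partialGroup) (a : ambient G) (H : set (ambient G)) :=
  [set pmul a h | h in H].

Definition rcoset (G : partialGroup) (H : set (ambient G)) (a : ambient G) :=
  [set pmul h a | h in H].

Definition normalizes (G : partialGroup) (A N : set (ambient G)) : Prop :=
  forall a, A a -> lcoset a N = rcoset N a.

Definition normal (G : partialGroup) (K : set (ambient G)) : Prop :=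
  normalizes (carrier G) K.

Definition setmul (G : partialGroup) (H K : set (ambient G)) :=
  [set pmul h k | h in H & k in K].

Definition cosets (G : partialGroup) (A N : set (ambient G)) :
    set (set (ambient G)) :=
  [set lcoset a N | a in A].

Lemma group_closedP (Gamma : groupType) (E : set Gamma) :
  group_closed (mem E) <->
  [/\ E 1, forall x y, E x -> E y -> E (x * y) & forall x, E x -> E x^-1].
Proof.
split=> [[/set_mem E1 EF]|[E1 EM EV]].
  have EV x : E x -> E x^-1.
    move=> Ex; have /set_mem := EF 1 x (mem_set E1) (mem_set Ex).
    by rewrite div1g.
  split=> // x y Ex Ey; rewrite -[y]invgK.
  by apply: set_mem (EF _ _ (mem_set Ex) (mem_set (EV _ Ey))).
split=> [|x y /set_mem Ex /set_mem Ey]; apply/mem_set => //.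
exact/EM/EV.
Qed.

Lemma support1 (G : partialGroup) : support G 1.
Proof. by have /group_closedP[] := support_group G. Qed.

Lemma supportM (G : partialGroup) x y :
  support G x -> support G y -> support G (x * y).
Proof. by have /group_closedP[_ + _] := support_group G; apply. Qed.

Lemma supportV (G : partialGroup) x : support G x -> support G x^-1.
Proof. by have /group_closedP[_ _] := support_group G; apply. Qed.

Lemma defect1 (G : partialGroup) : defect G 1.
Proof. by have [] := defect_free G. Qed.

Lemma supp_in (G : partialGroup) (a : ambient G) : support G (supp a).
Proof. by rewrite /supp; case: xgetP => [x _ []|_]; [|exact: support1]. Qed.

Lemma suppE (G : partialGroup) (x d : ambient G) :
  support G x -> defect G d -> supp (x * d) = x.
Proof.
move=> Ex Dd; rewrite /supp; case: xgetP => [y _ [Ey [d' Dd' eq_xy]]|/(_ x)].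
  have [_ [D' [sDD' [_ /group_closedP[_ D'M D'V] ED1 _]]]] := defect_free G.
  suff : [set 1] (y^-1 * x) by move=> yx1; rewrite -[y]mulg1 -yx1 mulVKg.
  rewrite -ED1; split; first by apply: supportM => //; apply: supportV.
  have -> : y^-1 * x = d' * d^-1.
    by apply: (mulgI y); apply: (mulIg d); rewrite mulVKg mulgA mulgVK.
  by apply: D'M; [exact: sDD'|exact/D'V/sDD'].
by case; split=> //; exists d.
Qed.

Lemma supp_id (G : partialGroup) (x : ambient G) : support G x -> supp x = x.
Proof. by move=> Ex; rewrite -{1}[x]mulg1 suppE//; exact: defect1. Qed.

Lemma suppK (G : partialGroup) (a : ambient G) : supp (supp a) = supp a.
Proof. exact/supp_id/supp_in. Qed.

Lemma suppM (G : partialGroup) (a b : ambient G) : supp (pmul a b) = pmul a b.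
Proof. by apply/supp_id/supportM; exact: supp_in. Qed.

Lemma suppV (G : partialGroup) (a : ambient G) :
  supp (supp a)^-1 = (supp a)^-1.
Proof. exact/supp_id/supportV/supp_in. Qed.

Lemma pmulA (G : partialGroup) (a b c : ambient G) :
  pmul a (pmul b c) = pmul (pmul a b) c.
Proof. by rewrite {1 3}/pmul !suppM /pmul mulgA. Qed.

Lemma pmul_suppl (G : partialGroup) (a b : ambient G) :
  pmul (supp a) b = pmul a b.
Proof. by rewrite /pmul suppK. Qed.

Lemma pmul_suppr (G : partialGroup) (a b : ambient G) :
  pmul a (supp b) = pmul a b.
Proof. by rewrite /pmul suppK. Qed.

Lemma pmul1g (G : partialGroup) (a : ambient G) : pmul 1 a = supp a.
Proof. by rewrite /pmul (supp_id (support1 G)) mul1g. Qed.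

Lemma pmulg1 (G : partialGroup) (a : ambient G) : pmul a 1 = supp a.
Proof. by rewrite /pmul (supp_id (support1 G)) mulg1. Qed.

Lemma support_carrier (G : partialGroup) : support G `<=` carrier G.
Proof. by move=> x Ex; exists x => //; exists 1; [exact: defect1|rewrite mulg1]. Qed.

Lemma partial_subgroup_supp (G : partialGroup) (H : set (ambient G)) a :
  partial_subgroup H -> H a -> H (supp a).
Proof. by case=> _ H1 HM _ Ha; rewrite -pmulg1; exact: HM. Qed.

Lemma partial_subgroup_inv (G : partialGroup) (H : set (ambient G)) a :
  partial_subgroup H -> H a -> H (supp a)^-1.
Proof.
move=> pH Ha; case: (pH) => _ _ _ /(_ a Ha)[_ [[d Dd <-]]].
move=> /(partial_subgroup_supp pH); rewrite suppE//.
exact/supportV/supp_in.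
Qed.

Lemma partial_subgroupI (G : partialGroup) (H K : set (ambient G)) :
  partial_subgroup H -> partial_subgroup K -> partial_subgroup (H `&` K).
Proof.
move=> pH pK; case: (pH) (pK) => [HG H1 HM _] [_ K1 KM _].
split=> [a [/HG]||a b [Ha Ka] [Hb Kb]|a [Ha Ka]] //.
  by split; [exact: HM|exact: KM].
exists (supp a)^-1; split; first by exists 1; [exact: defect1|rewrite mulg1].
by split; exact: partial_subgroup_inv.
Qed.

Lemma partial_subgroup_setmul (G : partialGroup) (H K : set (ambient G)) :
  partial_subgroup H -> partial_subgroup K -> normal K ->
  partial_subgroup (setmul H K).
Proof.
move=> pH pK nK; case: (pH) (pK) => [HG H1 HM _] [KG K1 KM _].
split.
- move=> _ [h Hh [k Kk <-]]; apply: support_carrier.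
  by apply: supportM; exact: supp_in.
- exists 1 => //; exists 1 => //.
  by rewrite pmulg1; apply/supp_id/support1.
- move=> _ _ [h Hh [k Kk <-]] [h' Hh' [k' Kk' <-]].
  have : rcoset K h' (pmul k h') by exists k.
  rewrite -nK; last exact: HG.
  move=> [k1 Kk1 kh']; exists (pmul h h'); first exact: HM.
  exists (pmul k1 k'); first exact: KM.
  by rewrite -pmulA [pmul h' _]pmulA kh' -!pmulA.
- move=> _ [h Hh [k Kk <-]]; exists (pmul h k)^-1; split.
    by exists 1; [exact: defect1|rewrite mulg1 suppM].
  have Hh' := partial_subgroup_inv pH Hh.
  have Kk' := partial_subgroup_inv pK Kk.
  have : rcoset K (supp h)^-1 (pmul (supp k)^-1 (supp h)^-1).
    by exists (supp k)^-1.
  rewrite -nK; last exact: HG.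
  move=> [k1 Kk1 k1E]; exists (supp h)^-1 => //; exists k1 => //.
  by rewrite k1E /pmul !suppV invgM.
Qed.

Lemma normalizesI (G : partialGroup) (H K : set (ambient G)) :
  partial_subgroup H -> partial_subgroup K -> normal K ->
  normalizes H (H `&` K).
Proof.
move=> pH pK nK a Ha; case: (pH) (pK) => [HG H1 HM _] [_ K1 KM _].
have Ha' := partial_subgroup_inv pH Ha.
apply/seteqP; split=> _ [h [Hh Kh] <-].
  have : lcoset a K (pmul a h) by exists h.
  rewrite nK; last exact: HG.
  move=> [k Kk kE]; exists (supp k); last by rewrite pmul_suppl.
  split; last exact: partial_subgroup_supp.
  have -> : supp k = pmul (pmul k a) (supp a)^-1.
    by rewrite {1}/pmul suppM suppV /pmul mulgK.
  by rewrite kE; apply/HM => //; apply/HM.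
have : rcoset K a (pmul h a) by exists h.
rewrite -nK; last exact: HG.
move=> [k Kk kE]; exists (supp k); last by rewrite pmul_suppr.
split; last exact: partial_subgroup_supp.
have -> : supp k = pmul (supp a)^-1 (pmul a k).
  by rewrite {1}/pmul suppM suppV /pmul mulKg.
by rewrite kE; apply/HM => //; apply/HM.
Qed.

(* N need not be contained in A: in HK/K the set HK lies in the support, which
   K need not do. *)
Definition quotientable (G : partialGroup) (A N : set (ambient G)) : Prop :=
  [/\ partial_subgroup A, partial_subgroup N & normalizes A N].

Lemma quotientable_setmul (G : partialGroup) (H K : set (ambient G)) :
  partial_subgroup H -> partial_subgroup K -> normal K ->
  quotientable (setmul H K) K.
Proof.
move=> pH pK nK; have pHK := partial_subgroup_setmul pH pK nK.
by split=> // a HKa; apply: nK; case: pHK => + _ _ _; apply.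
Qed.

Lemma quotientable_setI (G : partialGroup) (H K : set (ambient G)) :
  partial_subgroup H -> partial_subgroup K -> normal K ->
  quotientable H (H `&` K).
Proof.
by move=> pH pK nK; split;
  [|exact: partial_subgroupI|exact: normalizesI].
Qed.

Definition quotient (G : partialGroup) (A N : set (ambient G))
  (q : quotientable A N) : Type := set_type (cosets A N).

HB.instance Definition _ (G : partialGroup) (A N : set (ambient G))
  (q : quotientable A N) := Choice.on (quotient q).

Section QuotientGroup.
Context (G : partialGroup) (A N : set (ambient G)) (q : quotientable A N).
Implicit Types X Y Z : quotient q.

Definition to_quotient (X : set (ambient G)) (XAN : cosets A N X) :
  quotient q := exist _ X (mem_set XAN).

Fact quot_repr_subproof X : {a | A a & lcoset a N = \val X}.
Proof. by apply: cid2; case: X => X XAN /=; exact: (set_mem XAN). Qed.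

Definition quot_repr X : ambient G := s2val (quot_repr_subproof X).

Lemma quot_repr_in X : A (quot_repr X).
Proof. exact: s2valP (quot_repr_subproof X). Qed.

Lemma quot_reprE X : lcoset (quot_repr X) N = \val X.
Proof. exact: s2valP' (quot_repr_subproof X). Qed.

Lemma lcoset_in_cosets a : A a -> cosets A N (lcoset a N).
Proof. by move=> Aa; exists a. Qed.

Definition qcoset a (Aa : A a) : quotient q :=
  to_quotient (lcoset_in_cosets Aa).

Lemma val_qcoset a (Aa : A a) : \val (qcoset Aa) = lcoset a N.
Proof. by []. Qed.

Lemma quot_repr_mul_in X Y : A (pmul (quot_repr X) (quot_repr Y)).
Proof. by case: q => -[_ _ + _] _ _; apply; exact: quot_repr_in. Qed.

Definition quot_mul X Y : quotient q := qcoset (quot_repr_mul_in X Y).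

Lemma quot_one_in : A 1.
Proof. by case: q => -[]. Qed.

Definition quot_one : quotient q := qcoset quot_one_in.

Lemma quot_inv_in X : A (supp (quot_repr X))^-1.
Proof. by case: q => pA _ _; exact/(partial_subgroup_inv pA)/quot_repr_in. Qed.

Definition quot_inv X : quotient q := qcoset (quot_inv_in X).

Lemma lcoset_pmul a b : lcoset (pmul a b) N = pmul a @` lcoset b N.
Proof.
apply/seteqP; split=> [_ [n Nn <-]|_ [_ [n Nn <-] <-]].
  by exists (pmul b n); [exists n|rewrite pmulA].
by exists n; rewrite ?pmulA.
Qed.

Lemma pmul_rcoset a b : pmul a @` rcoset N b = (fun x => pmul x b) @` lcoset a N.
Proof.
apply/seteqP; split=> _ [_ [n Nn <-] <-].
  by exists (pmul a n); [exists n|rewrite pmulA].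
by exists (pmul n b); [exists n|rewrite pmulA].
Qed.

Lemma lcoset_pmul_compat a a' b b' : A b' ->
  lcoset a N = lcoset a' N -> lcoset b N = lcoset b' N ->
  lcoset (pmul a b) N = lcoset (pmul a' b') N.
Proof.
have [_ _ nN] := q => Ab' aa' bb'.
by rewrite !lcoset_pmul bb' nN// !pmul_rcoset aa'.
Qed.

Lemma quot_mulE X Y a b : A b -> \val X = lcoset a N -> \val Y = lcoset b N ->
  \val (quot_mul X Y) = lcoset (pmul a b) N.
Proof. by move=> Ab Xa Yb; apply: lcoset_pmul_compat; rewrite ?quot_reprE. Qed.

Lemma lcoset_supp a : lcoset (supp a) N = lcoset a N.
Proof. by apply: eq_imagel => n _; rewrite pmul_suppl. Qed.

Lemma quot_mulA : associative quot_mul.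
Proof.
move=> X Y Z; apply/val_inj.
rewrite (quot_mulE (quot_repr_mul_in Y Z) (esym (quot_reprE X)) (val_qcoset _)).
by rewrite (quot_mulE (quot_repr_in Z) (val_qcoset _) (esym (quot_reprE Z))) pmulA.
Qed.

Lemma quot_mul1 : left_id quot_one quot_mul.
Proof.
move=> X; apply/val_inj.
rewrite (quot_mulE (quot_repr_in X) (val_qcoset _) (esym (quot_reprE X))).
by rewrite pmul1g lcoset_supp quot_reprE.
Qed.

Lemma quot_mulr1 : right_id quot_one quot_mul.
Proof.
move=> X; apply/val_inj.
rewrite (quot_mulE quot_one_in (esym (quot_reprE X)) (val_qcoset _)).
by rewrite pmulg1 lcoset_supp quot_reprE.
Qed.

Lemma quot_mulV : left_inverse quot_one quot_inv quot_mul.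
Proof.
move=> X; apply/val_inj.
rewrite (quot_mulE (quot_repr_in X) (val_qcoset _) (esym (quot_reprE X))).
by rewrite /pmul suppV mulVg.
Qed.

Lemma quot_mulrV : right_inverse quot_one quot_inv quot_mul.
Proof.
move=> X; apply/val_inj.
rewrite (quot_mulE (quot_inv_in X) (esym (quot_reprE X)) (val_qcoset _)).
by rewrite /pmul suppV mulgV.
Qed.

HB.instance Definition _ := isGroup.Build (quotient q)
  quot_mulA quot_mul1 quot_mulr1 quot_mulV quot_mulrV.

(* Check that the group law of the quotient is (aN)(bN) = (a.b)N. *)
Lemma qcosetM a b (Aa : A a) (Ab : A b) (Aab : A (pmul a b)) :
  qcoset Aa * qcoset Ab = qcoset Aab.
Proof. by apply/val_inj/quot_mulE. Qed.

End QuotientGroup.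

(* For a in H, the coset aK is one of the cosets of HK/K, although a itself
   need not be in HK (which is contained in the support). *)
Lemma lcoset_in_setmul (G : partialGroup) (H K : set (ambient G)) a :
  partial_subgroup K -> H a -> cosets (setmul H K) K (lcoset a K).
Proof.
case=> _ K1 _ _ Ha; exists (pmul a 1); last by rewrite pmulg1 lcoset_supp.
by exists a => //; exists 1.
Qed.

Lemma group_supportT (Gamma : groupType) : group_closed (mem [set: Gamma]).
Proof. exact/group_closedP. Qed.

Lemma group_defect1 (Gamma : groupType) : free_with [set: Gamma] [set 1].
Proof.
split=> //; exists [set 1]; split=> //; split.
- exact: group_supportT.
- by apply/group_closedP; split=> // [x y -> ->|x ->]; rewrite ?mulg1 ?invg1.
- exact: setTI.
- by apply/seteqP; split=> // x _; exists x => //; exists 1; rewrite ?mulg1.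
Qed.

Definition partial_of_group (Gamma : groupType) : partialGroup :=
  PartialGroup (@group_supportT Gamma) (@group_defect1 Gamma).

(* A map between partial groups is given by a function on the ambient groups,
   of which only the values on the carrier matter. *)
Record is_hom (G1 G2 : partialGroup) (f : ambient G1 -> ambient G2) : Prop :=
  IsHom {
    hom_carrier : set_fun (carrier G1) (carrier G2) f;
    hom_support : set_fun (support G1) (support G2) f;
    hom_defect : set_fun (defect G1) (defect G2) f;
    hom_pmul : forall g h, carrier G1 g -> carrier G1 h ->
      pmul (f (pmul g h)) 1 = pmul (f g) (f h) }.

Definition is_isom (G1 G2 : partialGroup) (f : ambient G1 -> ambient G2) :
    Prop :=
  is_hom f /\ set_bij (carrier G1) (carrier G2) f.

(* Main.v *)
Require Import Defs.
From mathcomp Require Import all_boot boolp classical_sets functions.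

(** Every coset in [HK/K] is [aK] for some [a] in [H], because [(a.k)K = aK].
    For such an [a], [aK `&` H = a(H `&` K)]: if [a.k] is in [H], then so is
    the support part [a^-1.(a.k)] of [k] ([lcosetI]).  The map of the theorem is
    therefore [X |-> X `&` H], given on cosets as sets, so that no
    representative is chosen and there is nothing to check for it to be well
    defined.  It takes [aK] to [a(H `&` K)], so it is multiplicative and onto;
    it is injective because [X] is recovered from its image by multiplying with
    [K]: [a(H `&` K).K = aK] ([setmul_lcoset]).  Between groups, seen as partial
    groups, a multiplicative bijection is an isomorphism. *)

Local Open Scope classical_set_scope.
Local Open Scope group_scope.

(** * Cosets in a partial group *)

Section Cosets.
Context {G : partialGroup}.
Implicit Types (a h k : ambient G) (H K N : set (ambient G)).

Lemma pmulKg a k : pmul (supp a)^-1 (pmul a k) = supp k.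
Proof. by rewrite {1}/pmul suppV suppM /pmul mulKg. Qed.

Lemma pmulVKg a k : pmul a (pmul (supp a)^-1 k) = supp k.
Proof. by rewrite {1}/pmul suppM /pmul suppV mulVKg. Qed.

Lemma lcoset_pmulr K h k : partial_subgroup K -> K k ->
  lcoset (pmul h k) K = lcoset h K.
Proof.
move=> pK Kk; case: (pK) => _ _ KM _.
apply/seteqP; split=> _ [n Kn <-].
  by exists (pmul k n); [exact: KM|rewrite pmulA].
exists (pmul (supp k)^-1 n).
  by apply: KM => //; exact: partial_subgroup_inv.
by rewrite -pmulA pmulVKg pmul_suppr.
Qed.

Lemma cosets_setmul H K X : partial_subgroup K ->
  cosets (setmul H K) K X -> exists2 a, H a & lcoset a K = X.
Proof.
by move=> pK [_ [h Hh [k Kk <-]] <-]; exists h => //; rewrite lcoset_pmulr.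
Qed.

(** The intersection is taken in the ambient group.  This is harmless: a
    product [a.k] lies in the support, and of [k] only its support part, which
    is again in [K], enters into it. *)
Lemma lcosetI H K a : partial_subgroup H -> partial_subgroup K -> H a ->
  lcoset a (H `&` K) = lcoset a K `&` H.
Proof.
move=> pH pK Ha; case: (pH) => _ _ HM _.
apply/seteqP; split=> [_ [k [Hk Kk] <-]|_ [[k Kk <-] Hak]].
  by split; [exists k|exact: HM].
exists (supp k); last by rewrite pmul_suppr.
split; last exact: partial_subgroup_supp.
by rewrite -(pmulKg a); apply: HM => //; exact: partial_subgroup_inv.
Qed.

Lemma setmul_lcoset K N a : partial_subgroup K -> N 1 -> N `<=` K ->
  setmul (lcoset a N) K = lcoset a K.
Proof.
case=> _ _ KM _ N1 NK; apply/seteqP; split.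
  move=> _ [_ [n Nn <-] [k Kk <-]].
  by exists (pmul n k); [apply: KM => //; exact: NK|rewrite pmulA].
move=> _ [k Kk <-]; exists (pmul a 1); first by exists 1.
by exists k => //; rewrite pmulg1 pmul_suppl.
Qed.

End Cosets.

(** * Groups as partial groups *)

Section Groups.
Context {A B : groupType}.

Lemma carrier_group (C : groupType) : carrier (partial_of_group C) = setT.
Proof. by apply/seteqP; split=> // x _; exact: support_carrier. Qed.

Lemma pmul_group (C : groupType) (x y : C) :
  @pmul (partial_of_group C) x y = x * y.
Proof. by rewrite /pmul !(@supp_id (partial_of_group C)). Qed.

Lemma group_is_isom (f : A -> B) :
  {morph f : x y / x * y} -> bijective f ->
  @is_isom (partial_of_group A) (partial_of_group B) f.
Proof.
move=> fM bf; split; last by rewrite !carrier_group setTT_bijective.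
split.
- by move=> x _; rewrite carrier_group.
- by [].
- (* The defects are trivial groups, so what is asked is [f 1 = 1]. *)
  move=> _ ->; apply: (mulgI (f 1)).
  by rewrite -fM !mulg1.
- by move=> x y _ _; rewrite !pmul_group mulg1 fM.
Qed.

End Groups.

(** * The isomorphism *)

Section SecondIsomorphism.
Context {G : partialGroup} {H K : set (ambient G)}.
Context (pH : partial_subgroup H) (pK : partial_subgroup K) (nK : normal K).

Let HK_K := quotient (quotientable_setmul pH pK nK).
Let H_HIK := quotient (quotientable_setI pH pK nK).
Implicit Types (X Y : HK_K) (Z : H_HIK).

Lemma quotient_setmulP X : exists2 a, H a & lcoset a K = \val X.
Proof. by case: X => X cX; exact: cosets_setmul pK (set_mem cX). Qed.

Lemma cosets_setI X : cosets H (H `&` K) (\val X `&` H).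
Proof.
by have [a Ha <-] := quotient_setmulP X; exists a => //; exact: lcosetI.
Qed.

Definition restrict_coset X : H_HIK := to_quotient _ (cosets_setI X).

Lemma val_restrict_coset X a : H a -> \val X = lcoset a K ->
  \val (restrict_coset X) = lcoset a (H `&` K).
Proof. by move=> Ha XE; rewrite /= XE lcosetI. Qed.

Lemma restrict_cosetM : {morph restrict_coset : X Y / X * Y}.
Proof.
move=> X Y; have [a Ha /esym XE] := quotient_setmulP X.
have [b Hb /esym YE] := quotient_setmulP Y.
have Hab : H (pmul a b) by case: pH => _ _ + _; apply.
(* [b] need not lie in [HK], but its support part [b.1] does. *)
have HKb : setmul H K (supp b).
  by exists b => //; exists 1; [case: pK|rewrite pmulg1].
have XYE : \val (X * Y) = lcoset (pmul a b) K.
  by rewrite -pmul_suppr; apply: quot_mulE; rewrite ?lcoset_supp.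
apply/val_inj; rewrite (val_restrict_coset _ _ Hab XYE); apply/esym.
by apply: quot_mulE => //; exact: val_restrict_coset.
Qed.

Lemma restrict_coset_inj : injective restrict_coset.
Proof.
have [[_ H1 _ _] [_ K1 _ _]] := (pH, pK).
have XK X : \val X = setmul (\val (restrict_coset X)) K.
  have [a Ha aE] := quotient_setmulP X.
  by rewrite (val_restrict_coset _ _ Ha (esym aE)) setmul_lcoset// => ? [].
by move=> X Y XY; apply/val_inj; rewrite XK XY -XK.
Qed.

Lemma restrict_cosetE a (Ha : H a) :
  restrict_coset (to_quotient _ (lcoset_in_setmul pK Ha)) =
  to_quotient _ (lcoset_in_cosets (H `&` K) Ha).
Proof. by apply/val_inj; exact: val_restrict_coset. Qed.

Lemma restrict_coset_bij : bijective restrict_coset.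
Proof.
rewrite -setTT_bijective; split=> //;
  first by move=> X Y _ _ /restrict_coset_inj.
move=> Z _; case: Z => Z cZ; have [a Ha aZ] := set_mem cZ.
exists (to_quotient _ (lcoset_in_setmul pK Ha)) => //.
by rewrite restrict_cosetE; exact/val_inj.
Qed.

End SecondIsomorphism.

Local Close Scope group_scope.

Theorem theorem1p2 (G : partialGroup) (H K : set (ambient G))
    (pH : partial_subgroup H) (pK : partial_subgroup K) (nK : normal K) :
  let HK_K := quotient (quotientable_setmul pH pK nK) in
  let H_HIK := quotient (quotientable_setI pH pK nK) in
  exists f : HK_K -> H_HIK,
    @is_isom (partial_of_group HK_K) (partial_of_group H_HIK) f /\
    forall (a : ambient G) (Ha : H a),
      f (to_quotient _ (lcoset_in_setmul pK Ha)) =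
      to_quotient _ (lcoset_in_cosets (H `&` K) Ha).
Proof.
exists (restrict_coset pH pK nK); split; last exact: restrict_cosetE.
exact: group_is_isom (restrict_cosetM pH pK nK) (restrict_coset_bij pH pK nK).
Qed.
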